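(* The algorithm Greedy-1-Neighbour is a $\frac{\alpha}{2}(1-\frac{1}{e^\beta})$-approximation for the general 1-neighbour knapsack problem on directed and undirected graphs.
   Context: General 1-neighbour knapsack problem: given a graph $G=(V,E)$ (directed or undirected) where each vertex $v$ has a weight $w(v)$ and a profit $p(v)$, and a knapsack capacity $k$, find a set $U$ of vertices of maximum total profit with total weight at most $k$ such that every selected vertex with at least one neighbour (out-neighbour in the directed case) has at least one neighbour (out-neighbour) in $U$. Such a feasible set $U$ (i.e. $|N_{G[U]}(v)| \geq \min\{\delta_G(v),1\}$ for all $v\in U$) is called a 1-neighbour set. A family of graphs $\mathcal{H}$ is a viable family for $G$ if every subgraph $G'$ of $G$ can be partitioned into 1-neighbour sets for $G'$ each spanned by a graph in $\mathcal{H}$ (for directed graphs, spanned means by a directed subgraph with the same vertex set). A 1-neighbour set $U$ is viable with respect to $\mathcal{H}$ if some $H\in\mathcal{H}$ spans $G[U]$. For a vertex set $X$, $N^{-}_G(X)$ is the set of vertices not in $X$ having a neighbour (out-neighbour) in $X$. Fix a viable family $\mathcal{H}$. Assume an oracle Best-Profit-Viable that, given a graph and capacity, returns a viable set of weight at most the capacity whose profit is within a factor $\alpha$ of the maximum-profit such viable set, and an oracle Best-Ratio-Viable that returns a viable set of weight at most the capacity whose profit-to-weight ratio is within a factor $\beta$ of the best such ratio. Algorithm Greedy-1-Neighbour$(G,k)$: let $S_{\max}$ = Best-Profit-Viable$(G,k)$; set $K=k$, $U=\emptyset$, $G'=G$, $Z=\emptyset$. While there is either a viable set in $G'$ or a node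 in $Z$ with weight at most $K$: let $S_i$ = Best-Ratio-Viable$(G',K)$; let $s_i$ be the node of $Z$ (of weight at most $K$) maximizing $p(v)/w(v)$; if $p(s_i)/w(s_i) > p(S_i)/w(S_i)$ then replace $S_i$ by $\{s_i\}$; set $G' = G[V(G')\setminus S_i]$, $U = U\cup S_i$, $K = K - w(S_i)$, $Z = N^{-}_G(U)$; if $G$ is directed, remove from $G'$ every arc whose tail is in $Z$. Return whichever of $S_{\max}$ and $U$ has larger profit. *)

(* Defs.v *)
From mathcomp Require Import all_boot all_order all_algebra.
From mathcomp Require Import reals.

Set Implicit Arguments.
Unset Strict Implicit.
Unset Printing Implicit Defensive.

Import Order.TTheory GRing.Theory Num.Theory.
Local Open Scope ring_scope.

(* Finite graphs whose vertices are taken from [V]: directed when [dir] is true,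
   undirected (symmetric adjacency) when it is false.  The vertex set is a
   subset of [V], so that a graph and its subgraphs inhabit the same type. *)
Record graph (dir : bool) (V : finType) := Graph {
  vset : {set V};
  arc : rel V;
  arc_in : forall x y, arc x y -> (x \in vset) && (y \in vset);
  arc_sym : ~~ dir -> symmetric arc
}.

Section Graphs.

Variables (dir : bool) (V : finType).
Implicit Types (G : graph dir V) (U X Z : {set V}).

Definition nbr G (v : V) : {set V} := [set u | arc G v u].

Definition in_nbr G X : {set V} :=
  [set v | (v \notin X) && [exists u in X, arc G v u]].

Definition subgraph G' G : Prop :=
  vset G' \subset vset G /\ forall x y, arc G' x y -> arc G x y.

Definition induced_arc G X : rel V :=
  fun x y => [&& x \in X, y \in X & arc G x y].

Lemma induced_arc_in G X x y :
  induced_arc G X x y -> (x \in vset G :&: X) && (y \in vset G :&: X).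
Proof.
by case/and3P=> xX yX /arc_in /andP[xG yG]; rewrite !inE xX yX xG yG.
Qed.

Lemma induced_arc_sym G X : ~~ dir -> symmetric (induced_arc G X).
Proof.
by move=> ndir x y; rewrite /induced_arc (arc_sym G ndir) andbCA.
Qed.

Definition induced G X : graph dir V :=
  Graph (@induced_arc_in G X) (@induced_arc_sym G X).

(* The guard [dir] makes this the identity on undirected graphs. *)
Definition cut_arc G Z : rel V := fun x y => arc G x y && ~~ (dir && (x \in Z)).

Lemma cut_arc_in G Z x y :
  cut_arc G Z x y -> (x \in vset G) && (y \in vset G).
Proof. by case/andP=> /arc_in. Qed.

Lemma cut_arc_sym G Z : ~~ dir -> symmetric (cut_arc G Z).
Proof.
move=> ndir x y; rewrite /cut_arc (arc_sym G ndir); congr (_ && ~~ _).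
by rewrite (negPf ndir).
Qed.

Definition cut_tails G Z : graph dir V :=
  Graph (@cut_arc_in G Z) (@cut_arc_sym G Z).

Definition one_nbr_set G U : Prop :=
  U \subset vset G /\
  forall v, v \in U -> (minn #|nbr G v| 1 <= #|nbr (induced G U) v|)%N.

End Graphs.

(* A family of abstract graphs, on arbitrary finite vertex types. *)
Definition graph_family (dir : bool) := forall W : finType, graph dir W -> Prop.

Section Viability.

Variables (dir : bool) (V : finType) (F : graph_family dir).
Implicit Types (G : graph dir V) (U : {set V}).

(* [G[U]] has a subgraph with vertex set [U] that is a copy of [H]. *)
Definition spans (W : finType) (H : graph dir W) G U : Prop :=
  exists f : W -> V,
    [/\ {in vset H &, injective f},
        f @: vset H = U
      & forall x y, arc H x y -> arc (induced G U) (f x) (f y)].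

Definition spanned_by_family G U : Prop :=
  exists (W : finType) (H : graph dir W), F H /\ spans H G U.

Definition viable_family G : Prop :=
  forall G', subgraph G' G ->
  exists P : {set {set V}}, partition P (vset G') /\
    forall Y, Y \in P -> one_nbr_set G' Y /\ spanned_by_family G' Y.

(* The empty set is excluded: its profit-to-weight ratio is undefined, and
   selecting it would never exhaust the loop condition of the algorithm. *)
Definition viable G U : Prop :=
  [/\ U != set0, one_nbr_set G U & spanned_by_family G U].

End Viability.

Section Greedy.

Variables (R : realType) (dir : bool) (V : finType).
Variables (w p : V -> R) (F : graph_family dir).
Implicit Types (G : graph dir V) (K k : R) (S T U Z : {set V}).

Definition sum_over (f : V -> R) S : R := \sum_(v in S) f v.

Definition ratio S : R := sum_over p S / sum_over w S.

Definition feasible G k S : Prop := one_nbr_set G S /\ sum_over w S <= k.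

Definition approx_solution (c : R) G k S : Prop :=
  feasible G k S /\ forall T, feasible G k T -> c * sum_over p T <= sum_over p S.

Definition viable_within G K S : Prop := viable F G S /\ sum_over w S <= K.

Definition oracle := graph dir V -> R -> option {set V}.

(* [None] is the answer when no viable set fits in the given capacity. *)
Definition approx_oracle (value : {set V} -> R) (c : R) (O : oracle) : Prop :=
  forall G K,
  if O G K is Some X then
    viable_within G K X /\
    forall T, viable_within G K T -> c * value T <= value X
  else forall T, ~ viable_within G K T.

Definition best_profit_viable (a : R) (O : oracle) : Prop :=
  approx_oracle (sum_over p) a O.

Definition best_ratio_viable (b : R) (O : oracle) : Prop :=
  approx_oracle ratio b O.

Definition best_node Z K (s : V) : Prop :=
  [/\ s \in Z, w s <= K
    & forall t, t \in Z -> w t <= K -> p t / w t <= p s / w s].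

Record state := State {
  rest : graph dir V;
  capacity : R;
  chosen : {set V};
  fringe : {set V}
}.

Definition init_state G k : state := State G k set0 set0.

Definition can_continue (st : state) : Prop :=
  (exists S, viable_within (rest st) (capacity st) S) \/
  (exists s, s \in fringe st /\ w s <= capacity st).

(* When only one of the two candidates exists, it is the one selected. *)
Inductive selected (BR : oracle) (st : state) : {set V} -> Prop :=
| SelectSet S :
    BR (rest st) (capacity st) = Some S ->
    (forall s, best_node (fringe st) (capacity st) s ->
       ~~ (p s / w s > ratio S)) ->
    selected BR st S
| SelectNode s :
    best_node (fringe st) (capacity st) s ->
    (forall S, BR (rest st) (capacity st) = Some S -> p s / w s > ratio S) ->
    selected BR st [set s].

Definition next_state G (st : state) S : state :=
  let U := chosen st :|: S in
  let Z := in_nbr G U in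
  State (cut_tails (induced (rest st) (vset (rest st) :\: S)) Z)
        (capacity st - sum_over w S) U Z.

Definition greedy_step (BR : oracle) G (st st' : state) : Prop :=
  can_continue st /\ exists2 S, selected BR st S & st' = next_state G st S.

(* [greedy_loop BR G st U]: the loop started in [st] can end with chosen set
   [U]; this is a relation because ties in [best_node] are broken arbitrarily. *)
Inductive greedy_loop (BR : oracle) G : state -> {set V} -> Prop :=
| LoopEnd st : ~ can_continue st -> greedy_loop BR G st (chosen st)
| LoopStep st st' U :
    greedy_step BR G st st' -> greedy_loop BR G st' U -> greedy_loop BR G st U.

Definition greedy_terminates (BR : oracle) G k : Prop :=
  Acc (fun st' st => greedy_step BR G st st') (init_state G k).

Definition greedy_returns (BP BR : oracle) G k S : Prop :=
  exists2 U, greedy_loop BR G (init_state G k) U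
  & let Smax := odflt set0 (BP G k) in
    (S = Smax /\ sum_over p U <= sum_over p Smax) \/
    (S = U /\ sum_over p Smax <= sum_over p U).

(* The algorithm halts on every execution, some execution returns a set, and
   every returned set is a [c]-approximate solution. *)
Definition greedy_is_approximation (c : R) (BP BR : oracle) G k : Prop :=
  [/\ greedy_terminates BR G k,
      exists S, greedy_returns BP BR G k S
    & forall S, greedy_returns BP BR G k S -> approx_solution c G k S].

End Greedy.

(* Main.v *)
(* Let [T] be an optimal solution and [U] the set chosen so far.  The set
   [T \ U] splits into pieces that the algorithm may select: sets viable in the
   residual graph and single nodes of the fringe.  The densest piece [X] has
   [p X / w X >= (p T - p U) / k], so as long as it fits each selection
   [S] multiplies the gap [p T - p U] by at most [exp (- beta w(S) / k)].  The
   first time it does not fit, adding it would exceed the capacity, hence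
   [p U + p X >= (1 - exp (- beta)) p T].
   Such an [X] need not be viable in [G], but it is contained in a subset of [T]
   that is, so [alpha p(X) <= p(Smax)].  When [G] is undirected, the vertices of
   [T \ U] isolated there with a neighbour in [U] are split off as single nodes,
   each lying on a viable edge, and a viable partition of the rest is viable in
   [G].  When [G] is directed, choose an out-neighbour in [T] for each vertex of
   [T] having one: a viable partition cannot split the weak components of the
   resulting functional graph, and removing [U] and the arcs leaving the fringe
   only refines these components. *)
Require Import Defs.
From mathcomp Require Import all_boot all_order all_algebra.
From mathcomp Require Import reals sequences exp.

Set Implicit Arguments.
Unset Strict Implicit.
Unset Printing Implicit Defensive.

Import Order.TTheory GRing.Theory Num.Theory.
Local Open Scope ring_scope.

(* MathComp's [path.arc] and [fraction.ratio] shadow the notions of [Defs]. *)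
Local Notation arc := Defs.arc.
Local Notation ratio := Defs.ratio.

(** Averaging: if every block were strictly less dense than [D], summing over the nonempty partition
    would give [sum_over p D * sum_over w D] strictly below itself. Densities are compared by
    cross-multiplication. *)
Lemma sum_partition_ratio (R : realType) (I : finType) (w p : I -> R)
    (P : {set {set I}}) (D : {set I}) :
  partition P D -> D != set0 ->
  exists2 X, X \in P &
    sum_over w X * sum_over p D <= sum_over p X * sum_over w D.
Proof.
move=> PD D0; have /and3P[/eqP covP trivP _] := PD.
have sumE f : sum_over f D = \sum_(X in P) sum_over f X :> R.
  by rewrite /sum_over -covP (big_trivIset _ trivP).
have [X XP] : exists X, X \in P.
  have /set0Pn[x] := D0; rewrite -covP => /bigcupP[X XP _]; by exists X.
have [/exists_inP[Y YP leY]|/exists_inPn H] := boolP [exists Y in P,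
    sum_over w Y * sum_over p D <= sum_over p Y * sum_over w D].
  by exists Y.
suff : sum_over p D * sum_over w D < sum_over w D * sum_over p D.
  by rewrite mulrC ltxx.
rewrite [X in X * _ < _](sumE p) [X in _ < X * _](sumE w) !mulr_suml.
apply: ltr_sum => [|Y YP]; last by rewrite ltNge H.
by apply/hasP; exists X; rewrite ?mem_index_enum.
Qed.

(** * 1-neighbour sets, spanning and residual graphs *)

Section Graphs.
Variables (dir : bool) (V : finType).
Implicit Types (G H : graph dir V) (F : graph_family dir) (U X Z : {set V}).

Lemma one_nbr_setP G U :
  one_nbr_set G U <->
  U \subset vset G /\ forall v u, v \in U -> arc G v u ->
    exists2 u', u' \in U & arc G v u'.
Proof.
split=> -[sUG UP]; split=> // v.
  move=> u vU vu; have := UP v vU.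
  have /card_gt0P n0 : exists u, u \in nbr G v by exists u; rewrite inE.
  rewrite (minn_idPr n0) => /card_gt0P[u']; rewrite inE => /and3P[_ u'U vu'].
  by exists u'.
move=> vU; have [->|] := posnP #|nbr G v|; first by rewrite min0n.
move=> n0; rewrite (minn_idPr n0); have /card_gt0P[u] := n0.
rewrite inE => /(UP _ _ vU)[u' u'U vu']; apply/card_gt0P; exists u'.
by rewrite inE /= /induced_arc vU u'U.
Qed.

(** Spanning only looks at arcs inside [U], so it passes between [G], its subgraphs and its residual
    graphs. *)
Lemma spanned_by_familyS F G H U :
  (forall x y, x \in U -> y \in U -> arc G x y -> arc H x y) ->
  spanned_by_family F G U -> spanned_by_family F H U.
Proof.
move=> sub [W [K [FK [f [finj fU farc]]]]].
exists W, K; split=> //; exists f; split=> // x y /farc /and3P[xU yU xy].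
by apply/and3P; split=> //; apply: sub.
Qed.

Lemma viable_familyS F G H :
  subgraph H G -> viable_family F G -> viable_family F H.
Proof.
move=> [sHG aHG] FG K [sKH aKH]; apply: FG; split=> [|x y /aKH /aHG //].
exact: subset_trans sKH sHG.
Qed.

(** Describes the working graph of the algorithm from the chosen set alone, although the loop
    reaches it by successive deletions. *)
Definition residual G U H : Prop :=
  vset H = vset G :\: U /\
  forall x y, arc H x y =
    [&& x \notin U, y \notin U, arc G x y & ~~ (dir && (x \in in_nbr G U))].

Lemma residual_subgraph G U H : residual G U H -> subgraph H G.
Proof.
by case=> vH aH; split=> [|x y]; rewrite ?vH ?subsetDl// aH => /and4P[].
Qed.

Lemma in_nbr0 G : in_nbr G set0 = set0.
Proof.
apply/setP=> x; rewrite !inE /=; apply/exists_inP => -[y]; by rewrite inE.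
Qed.

Lemma residual0 G : residual G set0 G.
Proof.
by split=> [|x y]; rewrite ?setD0// in_nbr0 !inE andbF andbT.
Qed.

(* [X'] is a witness that the profit of [X] is at most that of a viable set of
   [G] contained in [T], although [X] itself need not be viable in [G]. *)
Definition piece F G H Z (T X : {set V}) : Prop :=
  (viable F H X \/ exists2 s, s \in Z & X = [set s]) /\
  exists X', [/\ viable F G X', X \subset X' & X' \subset T].

End Graphs.

(** * Weak components of functional graphs *)

Section Directed.
Variable V : finType.
Implicit Types (G H : graph true V) (F : graph_family true).
Implicit Types (A U X Z : {set V}) (f : V -> V) (a : pred V).

Definition fun_arc A a f : rel V := fun x y => [&& x \in A, a x & y == f x].

Definition fun_connect A a f : rel V :=
  connect (fun x y => fun_arc A a f x y || fun_arc A a f y x).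

Lemma fun_connect_equiv A a f : equivalence_rel (fun_connect A a f).
Proof.
have sym : connect_sym (fun x y => fun_arc A a f x y || fun_arc A a f y x).
  by apply: sym_connect_sym => x y; rewrite orbC.
move=> x y z; split; first exact: connect0.
move=> xy; exact: (same_connect sym xy).
Qed.

Definition component A a f x : {set V} := [set y in A | fun_connect A a f x y].

Lemma component_fun A a f x y :
  {in A, forall z, a z -> f z \in A} ->
  y \in component A a f x -> a y -> f y \in component A a f x.
Proof.
move=> fA; rewrite !inE => /andP[yA xy] ay; rewrite fA//=.
by apply: connect_trans xy (connect1 _); rewrite /fun_arc yA ay eqxx.
Qed.

(* In a functional graph a block containing an arc's tail must contain its head,
   so no viable partition can split a weak component. *)
Lemma component_spanned F H A a f x :
  viable_family F H -> A \subset vset H ->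
  {in A, forall z, a z -> f z \in A /\ arc H z (f z)} ->
  x \in A -> spanned_by_family F H (component A a f x).
Proof.
move=> FH sAH fA xA; set C := component A a f x.
have fC y : y \in C -> a y -> f y \in C.
  by apply: component_fun => z zA az; case: (fA z zA az).
have CA y : y \in C -> y \in A by rewrite inE => /andP[].
have kP u v : [&& u \in C, a u & v == f u] -> (u \in C) && (v \in C).
  by case/and3P=> uC au /eqP->; rewrite uC fC.
have kS : ~~ true -> symmetric (fun u v => [&& u \in C, a u & v == f u]) by [].
(* Viability of the family is applied to the bare functional graph on the component, where [f y] is
   the only possible out-neighbour of [y]. *)
pose K := Graph kP kS.
have [|P [/and3P[/eqP covP trivP _] PV]] := FH K.
  split=> [|u v /and3P[uC au /eqP->]]; last by case: (fA u (CA u uC) au).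
  by apply: subset_trans sAH; apply/subsetP.
have xC : x \in C by rewrite inE xA /=; apply: connect0.
have Pcov y : y \in C -> exists2 Y, Y \in P & y \in Y.
  by rewrite -[C]covP => /bigcupP[Y]; exists Y.
have YC Y : Y \in P -> Y \subset C.
  by move=> YP; have [/one_nbr_setP[]] := PV Y YP.
have fY Y y : Y \in P -> y \in Y -> a y -> f y \in Y.
  move=> YP yY ay; have [/one_nbr_setP[sYC Y1] _] := PV Y YP.
  have yC := subsetP sYC y yY.
  have [|u uY /and3P[_ _ /eqP <-]//] := Y1 y (f y) yY.
  by rewrite /= yC ay eqxx.
have [Y YP xY] := Pcov x xC.
suff -> : C = Y by apply: spanned_by_familyS (PV Y YP).2 => u v _ _
  /and3P[uC au /eqP->]; case: (fA u (CA u uC) au).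
apply/eqP; rewrite eqEsubset (YC Y YP) andbT; apply/subsetP => y.
rewrite inE => /andP[_]; rewrite /fun_connect => xy.
rewrite -(closed_connect _ xy)//; apply: intro_closed.
  by apply: sym_connect_sym => u v; rewrite orbC.
move=> u v /orP[]/and3P[zA az /eqP->]; first by move=> uY; apply: fY.
move=> fvY; have vC : v \in C.
  rewrite inE zA; have := subsetP (YC Y YP) _ fvY; rewrite inE => /andP[_] xfv.
  apply: connect_trans xfv (connect1 _).
  by rewrite /fun_arc zA az eqxx orbT.
(* Closure against the arcs: the block [Y'] of [v] also contains [f v], and blocks sharing [f v]
   coincide. *)
have [Y' Y'P vY'] := Pcov v vC.
have fvY' := fY _ _ Y'P vY' az.
suff -> : Y = Y' by [].
by rewrite -(def_pblock trivP YP fvY) (def_pblock trivP Y'P fvY').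
Qed.

End Directed.

(** * Splitting the unchosen part of a solution into pieces *)

Section Pieces.
Variable V : finType.
Implicit Types (T U : {set V}).

Lemma directed_pieces F (G H : graph true V) T U :
  viable_family F G -> residual G U H -> one_nbr_set G T ->
  exists P, partition P (T :\: U) /\
    forall X, X \in P -> piece F G H (in_nbr G U) T X.
Proof.
move=> FG resH /one_nbr_setP[sTG T1].
(* For [v] in [T], the default is taken only when [v] has no out-neighbour in [G]; the predicate [a]
   below excludes such vertices. *)
pose f v := odflt v [pick u in T | arc G v u].
have fP v : v \in T -> nbr G v != set0 -> f v \in T /\ arc G v (f v).
  move=> vT /set0Pn[u]; rewrite inE => /T1[//|u' u'T vu']; rewrite /f.
  case: pickP => [x /andP[]//|/(_ u')]; by rewrite u'T vu'.
pose a U' v := (nbr G v != set0) && (v \notin in_nbr G U').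
(* Needed twice: for [U], giving the pieces, and for [set0], where the residual graph is [G], giving
   the sets of [G] that contain them. Fringe vertices fail [a U'], having lost their outgoing arcs,
   so they are sinks. *)
have compV U' K x : residual G U' K -> x \in T :\: U' ->
    viable F K (component (T :\: U') (a U') f x).
  move=> resK xA; have [vK aK] := resK.
  have fA : {in T :\: U', forall z, a U' z -> f z \in T :\: U' /\ arc K z (f z)}.
    move=> z /setDP[zT zU] /andP[z0 zN]; have [fzT zf] := fP z zT z0.
    have fzU : f z \notin U'.
      apply: contra zN => fzU; rewrite inE zU; apply/exists_inP.
      by exists (f z).
    by rewrite inE fzT fzU aK zU fzU zf zN.
  have sAK : T :\: U' \subset vset K by rewrite vK setSD.
  split.
  - by apply/set0Pn; exists x; rewrite inE xA; apply: connect0.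
  - apply/one_nbr_setP; split.
      by apply: subset_trans sAK; apply/subsetP => y; rewrite inE => /andP[].
    move=> v u vC; rewrite aK => /and4P[vU uU vu vN].
    have av : a U' v by rewrite /a vN andbT; apply/set0Pn; exists u; rewrite inE.
    exists (f v); first by apply: component_fun => // z zA /(fA z zA)[].
    by have := vC; rewrite inE => /andP[vA _]; case: (fA v vA av).
  - apply: component_spanned => //.
    exact: viable_familyS (residual_subgraph resK) FG.
pose r := fun_connect (T :\: U) (a U) f.
exists (equivalence_partition r (T :\: U)); split.
  by apply: equivalence_partitionP => x y z _ _ _; apply: fun_connect_equiv.
move=> _ /imsetP[x xA ->]; split; first by left; apply: compV.
have [xT xU] := setDP xA.
exists (component (T :\: set0) (a set0) f x); split.
- by apply: compV (residual0 G) _; rewrite setD0.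
- apply/subsetP => y; rewrite !inE => /andP[/andP[_ yT] xy].
  (* Every functional arc that survives the choice of [U] was already present for [set0], so
     components only shrink. *)
  rewrite yT; move: xy; apply: connect_sub => u v uv; apply: connect1.
  by case/orP: uv => /and3P[/setDP[uT _] /andP[u0 _] uf]; apply/orP;
    [left|right]; apply/and3P; rewrite /a in_nbr0 !inE uT u0.
- by apply/subsetP => y; rewrite !inE => /andP[].
Qed.

Lemma partition_setU1s (P : {set {set V}}) (D B : {set V}) :
  partition P D -> [disjoint D & B] ->
  partition (P :|: [set [set z] | z in B]) (D :|: B).
Proof.
case/and3P=> /eqP covP trivP P0 dDB.
have covB : cover [set [set z] | z in B] = B.
  apply/setP=> z; apply/bigcupP/idP => [[_ /imsetP[y yB ->]]|zB].
    by rewrite inE => /eqP->.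
  by exists [set z]; rewrite ?set11// imset_f.
apply/and3P; split.
- by rewrite /cover bigcup_setU -/(cover _) -/(cover _) covP covB.
- apply: trivIsetU; rewrite ?covP ?covB ?trivP//.
  apply/trivIsetP => _ _ /imsetP[x _ ->] /imsetP[y _ ->] xy.
  by rewrite disjoints1 inE; apply: contraNneq xy => ->.
- rewrite inE negb_or P0; apply/imsetP => -[z _ /setP/(_ z)].
  by rewrite !inE eqxx.
Qed.

(** The family is applied to the subgraph made of this single edge: the block of [z] must contain
    its only neighbour [y], so it is the whole edge. *)
Lemma edge_viable F (G : graph false V) z y :
  viable_family F G -> arc G z y -> z != y -> viable F G [set z; y].
Proof.
move=> FG zy nzy; have symG := @arc_sym _ _ G isT.
have [zG yG] := andP (arc_in zy).
pose e u v := (u == z) && (v == y) || (u == y) && (v == z).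
have e_in u v : e u v -> (u \in [set z; y]) && (v \in [set z; y]).
  by case/orP=> /andP[/eqP-> /eqP->]; rewrite !inE !eqxx ?orbT.
have e_sym : ~~ false -> symmetric e.
  by move=> _ u v; rewrite /e orbC andbC [X in _ || X]andbC.
pose K := Graph e_in e_sym.
have eG u v : e u v -> arc G u v.
  by case/orP=> /andP[/eqP-> /eqP->//]; rewrite symG.
have sKG : subgraph K G.
  split=> //=; by apply/subsetP => u; rewrite !inE => /orP[]/eqP->.
have [P [/and3P[/eqP covP _ _] PV]] := FG K sKG.
have : z \in cover P by rewrite covP !inE eqxx.
case/bigcupP => Y YP zYin.
have [/one_nbr_setP[sY Y1] sp] := PV Y YP.
have -> : [set z; y] = Y.
  apply/eqP; rewrite eqEsubset [Y \subset _]sY andbT.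
  apply/subsetP => u; rewrite !inE => /orP[]/eqP-> //.
  have [|u' u'Y] := Y1 z y zYin; first by rewrite /= /e !eqxx.
  by rewrite /= /e eqxx (negPf nzy) orbF => /eqP<-.
split; first by apply/set0Pn; exists z.
  apply/one_nbr_setP; split; first exact: subset_trans sY sKG.1.
  move=> v u vY _; have := subsetP sY v vY; rewrite !inE => /orP[]/eqP vE.
    have [|u' u'Y /eG vu'] := Y1 v y vY; first by rewrite /= /e vE !eqxx.
    by exists u'.
  have [|u' u'Y /eG vu'] := Y1 v z vY; first by rewrite /= /e vE !eqxx orbT.
  by exists u'.
apply: spanned_by_familyS sp => u v _ _; apply: eG.
Qed.

Lemma undirected_pieces F (G H : graph false V) T U :
  viable_family F G -> residual G U H -> one_nbr_set G T ->
  exists P, partition P (T :\: U) /\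
    forall X, X \in P -> piece F G H (in_nbr G U) T X.
Proof.
move=> FG [vH aH] /one_nbr_setP[sTG T1].
have symG := @arc_sym _ _ G isT.
pose D := T :\: U.
pose B := [set z in D | (z \in in_nbr G U) && [forall u in D, ~~ arc G z u]].
have sBD : B \subset D by apply/subsetP => z; rewrite inE => /andP[].
pose K := induced G (D :\: B).
have KE : vset K = D :\: B.
  apply/setIidPr/(subset_trans _ sTG)/(subset_trans (subsetDl _ _)).
  exact: subsetDl.
have [|P [PD PV]] := FG K.
  by split=> [|x y /and3P[]//]; rewrite subsetIl.
rewrite KE in PD.
exists (P :|: [set [set z] | z in B]); split.
  rewrite -[T :\: U]/D; have <- : (D :\: B) :|: B = D.
    by rewrite -[RHS](setID _ B) (setIidPr sBD) setUC.
  apply: partition_setU1s => //.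
  by rewrite disjoints_subset subsetDr.
move=> X /setUP[XP|/imsetP[z zB ->]].
  have [/one_nbr_setP[sX X1] spX] := PV X XP.
  rewrite KE in sX.
  (* Outside [B], a vertex with a neighbour in [G] has one in [D]. By symmetry that neighbour is not
     isolated in [D], hence also avoids [B], so the block supplies a neighbour. Thus [X] is its own
     witness. *)
  have XG v u : v \in X -> arc G v u -> exists2 u', u' \in X & arc G v u'.
    move=> vX vu; have /setDP[vD vB] := subsetP sX v vX.
    have [vT vU] := setDP vD.
    have [x xD vx] : exists2 x, x \in D & arc G v x.
      have [x xT vx] := T1 v u vT vu.
      have [xU|xU] := boolP (x \in U); last by exists x; rewrite // inE xU.
      move: vB; rewrite inE vD /= negb_and => /orP[].
        by rewrite inE vU => /exists_inP[]; exists x.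
      by case/forall_inPn => y yD /negPn; exists y.
    have xB : x \notin B.
      apply: contraL vx; rewrite inE symG => /and3P[_ _ /forall_inP]; exact.
    have [|u' u'X /and3P[_ _ vu']] := X1 v x vX; last by exists u'.
    by apply/and3P; split=> //; apply/setDP.
  have XD x : x \in X -> (x \in T) && (x \notin U).
    by move=> /(subsetP sX)/setDP[/setDP[-> ->]].
  have X0 : X != set0.
    by apply: contraTneq XP => ->; case/and3P: PD.
  have XH x y : x \in X -> y \in X -> arc G x y -> arc H x y.
    by move=> /XD/andP[_ xU] /XD/andP[_ yU] xy; rewrite aH xU yU xy.
  have sXT : X \subset T by apply/subsetP => x /XD/andP[].
  split; [left|exists X]; split=> //.
  - apply/one_nbr_setP; split.
      by rewrite vH; apply/subsetP => x /XD/andP[xT xU];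
         rewrite inE xU (subsetP sTG).
    move=> v u vX; rewrite aH => /and4P[_ _ vu _].
    have [u' u'X vu'] := XG v u vX vu; exists u' => //; exact: XH.
  - by apply: spanned_by_familyS spX => x y xX yX /and3P[_ _]; apply: XH.
  - split=> //; first by apply/one_nbr_setP; split=> //; apply: subset_trans sTG.
    by apply: spanned_by_familyS spX => x y xX yX /and3P[].
have := zB; rewrite inE => /and3P[zD zN /forall_inP ziso].
have [zT zU] := setDP zD.
split; first by right; exists z.
have := zN; rewrite inE => /andP[_ /exists_inP[u _ zu]].
(* The neighbour [u] in [U] may lie outside [T], while the witness edge must stay in [T]. The
   neighbour [y] in [T] is in [U] because [z] is isolated in [D], so [y] differs from [z]. *)
have [y yT zy] := T1 z u zT zu.
have yU : y \in U.
  by apply: contraLR zy => yU; apply: ziso; rewrite inE yU.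
exists [set z; y]; split; last 2 first.
- by apply/subsetP => x; rewrite !inE => ->.
- by apply/subsetP => x; rewrite !inE => /orP[]/eqP->.
- by apply: edge_viable => //; apply: contraNneq zU => ->.
Qed.

End Pieces.

Lemma residual_pieces dir V F (G H : graph dir V) (T U : {set V}) :
  viable_family F G -> residual G U H -> one_nbr_set G T ->
  exists P, partition P (T :\: U) /\
    forall X, X \in P -> piece F G H (in_nbr G U) T X.
Proof.
by case: dir F G H => F G H; [apply: directed_pieces|apply: undirected_pieces].
Qed.

(** * Executions of the greedy loop: invariant, termination, existence *)

Section Greedy.
Variables (R : realType) (dir : bool) (V : finType) (w p : V -> R) (k : R).
Variables (G : graph dir V) (F : graph_family dir).
Variables (alpha beta : R) (BP BR : oracle R dir V).
Hypotheses (w_gt0 : forall v, 0 < w v) (p_ge0 : forall v, 0 <= p v).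
Hypotheses (k_ge0 : 0 <= k) (F_viable : viable_family F G).
Hypotheses (alpha_gt0 : 0 < alpha) (alpha_le1 : alpha <= 1).
Hypotheses (beta_gt0 : 0 < beta) (beta_le1 : beta <= 1).
Hypotheses (BP_spec : best_profit_viable w p F alpha BP).
Hypotheses (BR_spec : best_ratio_viable w p F beta BR).
Implicit Types (st : state R dir V) (S T U X : {set V}).

Lemma sum_over0 (f : V -> R) : sum_over f set0 = 0.
Proof. exact: big_set0. Qed.

Lemma sum_over1 (f : V -> R) s : sum_over f [set s] = f s.
Proof. exact: big_set1. Qed.

Lemma sum_overU (f : V -> R) U S :
  [disjoint U & S] -> sum_over f (U :|: S) = sum_over f U + sum_over f S.
Proof.
by move=> dUS; rewrite /sum_over -bigU//; apply: eq_bigl => x; rewrite !inE.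
Qed.

Lemma sum_over_sub (f : V -> R) S T :
  (forall v, 0 <= f v) -> S \subset T -> sum_over f S <= sum_over f T.
Proof.
move=> f_ge0 sST; rewrite -(setID T S) (setIidPr sST) sum_overU.
  by rewrite lerDl sumr_ge0.
by rewrite disjoint_sym disjoints_subset subsetDr.
Qed.

Let p_sum_ge0 S : 0 <= sum_over p S.
Proof. exact: sumr_ge0. Qed.

Let w_sum_ge0 S : 0 <= sum_over w S.
Proof. by apply: sumr_ge0 => v _; exact: ltW. Qed.

Let w_sum_gt0 S : S != set0 -> 0 < sum_over w S.
Proof.
case/set0Pn=> s sS; rewrite /sum_over (big_setD1 s)//= ltr_pwDl//.
exact: w_sum_ge0.
Qed.

Definition loop_inv st : Prop :=
  [/\ residual G (chosen st) (rest st), fringe st = in_nbr G (chosen st),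
      one_nbr_set G (chosen st), capacity st = k - sum_over w (chosen st)
    & 0 <= capacity st].

Lemma loop_inv_init : loop_inv (init_state G k).
Proof.
split=> //=; first exact: residual0.
- by rewrite in_nbr0.
- by apply/one_nbr_setP; split=> [|v u]; rewrite ?sub0set ?inE.
- by rewrite sum_over0 subr0.
Qed.

(** A fringe vertex stays in the fringe until it is chosen, so arcs cut in earlier iterations are
    among those the current fringe prescribes. *)
Lemma in_nbrS U U' x :
  U \subset U' -> x \notin U' -> x \in in_nbr G U -> x \in in_nbr G U'.
Proof.
move=> sUU' xU'; rewrite !inE xU' => /andP[_ /exists_inP[y yU xy]].
by apply/exists_inP; exists y => //; apply: (subsetP sUU').
Qed.

Lemma selected_cases st S : selected w p BR st S ->
  viable_within w F (rest st) (capacity st) S \/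
  exists s, [/\ s \in fringe st, w s <= capacity st & S = [set s]].
Proof.
case=> {S} [S BRS _|s [sZ sw _] _]; last by right; exists s.
by left; have := BR_spec (rest st) (capacity st); rewrite BRS => -[].
Qed.

Lemma selected_sub st S : loop_inv st -> selected w p BR st S ->
  [/\ S != set0, S \subset vset G, [disjoint chosen st & S]
    & sum_over w S <= capacity st].
Proof.
move=> [[vH aH] fE _ _ _] /selected_cases[[[S0 [sS _] _] wS]|].
  rewrite vH subsetD in sS; case/andP: sS => sS dS.
  by split=> //; rewrite disjoint_sym.
move=> [s [sZ sw ->]]; move: sZ; rewrite fE inE => /andP[sU /exists_inP[u _ su]].
split; last by rewrite sum_over1.
- by apply/set0Pn; exists s; rewrite inE.
- by rewrite sub1set; case/andP: (arc_in su).
- by rewrite disjoint_sym disjoints1.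
Qed.

Lemma loop_inv_next st S :
  loop_inv st -> selected w p BR st S -> loop_inv (next_state w G st S).
Proof.
move=> inv sel; have [S0 sSG dS wS] := selected_sub inv sel.
have [[vH aH] fE /one_nbr_setP[sUG U1] capE cap0] := inv.
split=> //=; last by rewrite subr_ge0.
- split=> [|x y] /=.
    apply/setP=> x; rewrite vH !inE.
    by case: (x \in chosen st); case: (x \in S); case: (x \in vset G).
  rewrite /cut_arc /= /induced_arc aH vH !in_setD !in_setU !negb_or.
  have [xU|xU] /= := boolP (x \in chosen st); first by rewrite !andbF.
  have [xS|xS] //= := boolP (x \in S).
  have [yU|yU] /= := boolP (y \in chosen st); first by rewrite !andbF.
  have [yS|yS] /= := boolP (y \in S); first by rewrite !andbF.
  have [xy|xy] /= := boolP (arc G x y); last by rewrite !andbF.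
  have /andP[-> ->] /= := arc_in xy.
  have [xN|_] := boolP (x \in in_nbr G (chosen st)); last by rewrite andbF.
  suff -> : x \in in_nbr G (chosen st :|: S) by rewrite andbb.
  by apply: in_nbrS xN; rewrite ?subsetUl// inE negb_or xU.
- apply/one_nbr_setP; split; first by rewrite subUset sUG.
  have old v u : v \in chosen st -> arc G v u ->
      exists2 u', u' \in chosen st :|: S & arc G v u'.
    by move=> vU /(U1 _ _ vU)[u' u'U vu']; exists u' => //; rewrite inE u'U.
  have fr v : v \in in_nbr G (chosen st) ->
      exists2 u', u' \in chosen st :|: S & arc G v u'.
    by rewrite inE => /andP[_ /exists_inP[u uU vu]]; exists u; rewrite // inE uU.
  move=> v u /setUP[|vS] vu; first by move=> /old; apply.
  (* A selected fringe vertex already has a chosen neighbour. Any other selected vertex has kept all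
     its arcs, so the 1-neighbour property in the residual graph suffices. *)
  have [vN|vN] := boolP (v \in in_nbr G (chosen st)); first exact: fr.
  case: (selected_cases sel) => [[[_ /one_nbr_setP[_ S1] _] _]|[s [sZ _ SE]]].
    have vU : v \notin chosen st by rewrite (disjointFl dS vS).
    have uU : u \notin chosen st.
      apply: contra vN => uU; rewrite inE vU; apply/exists_inP; by exists u.
    have [|u' u'S] := S1 v u vS; first by rewrite aH vU uU vu (negPf vN) andbF.
    by rewrite aH => /and4P[_ _ vu' _]; exists u'; rewrite // inE u'S orbT.
  by move: vS vN; rewrite SE inE => /eqP->; rewrite -fE sZ.
- by rewrite sum_overU// capE opprD addrA.
Qed.

(** Selections are nonempty and disjoint from the chosen set, so the number of unchosen vertices is
    a termination measure. *)
Lemma greedy_step_inv st st' :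
  loop_inv st -> greedy_step w p F BR G st st' ->
  loop_inv st' /\ (#|~: chosen st'| < #|~: chosen st|)%N.
Proof.
move=> inv [_ [S sel ->]]; split; first exact: loop_inv_next.
have [/set0Pn[s sS] _ dS _] := selected_sub inv sel.
apply/proper_card/properP; split; first by rewrite setCS subsetUl.
by exists s; rewrite !inE ?sS ?orbT// (disjointFl dS sS).
Qed.

Lemma loop_inv_acc st : loop_inv st ->
  Acc (fun st' st => greedy_step w p F BR G st st') st.
Proof.
have [n] := ubnP #|~: chosen st|; elim: n st => [|n IHn] st ltn inv.
  by rewrite ltn0 in ltn.
constructor=> st' /(greedy_step_inv inv)[inv' lt'].
by apply: IHn inv'; apply: leq_trans lt' ltn.
Qed.

Lemma best_node_exists (Z : {set V}) (K : R) s0 :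
  s0 \in Z -> w s0 <= K -> exists s, best_node w p Z K s.
Proof.
move=> s0Z s0K; pose Q : {pred V} := [pred s | (s \in Z) && (w s <= K)].
have Q0 : Q s0 by rewrite /Q /= s0Z.
case: (arg_maxP (fun s => p s / w s) Q0) => s /andP[sZ sK] smax.
by exists s; split=> // t tZ tK; apply: smax; rewrite /Q /= tZ.
Qed.

(** The loop condition involves an arbitrary family, yet the oracle decides it: [None] certifies
    that no viable set fits. *)
Lemma can_continueP st :
  {can_continue w F st /\ exists S, selected w p BR st S} +
  {~ can_continue w F st}.
Proof.
have := BR_spec (rest st) (capacity st).
have [/exists_inP has_node|/exists_inPn no_node] :=
  boolP [exists s in fringe st, w s <= capacity st].
  move=> BRst; left; split; first by right; case: has_node => s ?; exists s.
  have [s s_best] : exists s, best_node w p (fringe st) (capacity st) s.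
    have [s0 s0Z s0w] := has_node.
    exact: best_node_exists s0Z s0w.
  case E: (BR (rest st) (capacity st)) => [S|].
    have [gt_s|le_s] := boolP (p s / w s > ratio w p S).
      by exists [set s]; apply: SelectNode => // S'; rewrite E => -[<-].
    exists S; apply: SelectSet => // s' [s'Z s'w _].
    rewrite -leNgt; rewrite -leNgt in le_s.
    by apply: le_trans le_s; case: s_best => _ _; apply.
  by exists [set s]; apply: SelectNode => // S'; rewrite E.
case E: (BR _ _) => [S|] BRst.
  left; split; first by left; exists S; case: BRst.
  exists S; apply: SelectSet => // s [sZ sw _].
  by move: (no_node s sZ); rewrite sw.
right=> -[[S] /BRst //|[s [sZ sw]]].
by move: (no_node s sZ); rewrite sw.
Qed.

Lemma greedy_loop_exists st : loop_inv st ->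
  exists U, greedy_loop w p F BR G st U.
Proof.
move=> /loop_inv_acc; elim=> {}st _ IH.
have [[cont [S sel]]|stop] := can_continueP st; last first.
  by exists (chosen st); apply: LoopEnd.
have step : greedy_step w p F BR G st (next_state w G st S).
  by split=> //; exists S.
by have [U] := IH _ step; exists U; apply: LoopStep step _.
Qed.

Lemma greedy_loop_inv st U : greedy_loop w p F BR G st U -> loop_inv st ->
  [/\ one_nbr_set G U, sum_over w U <= k & chosen st \subset U].
Proof.
elim=> {st U} [st _ [_ _ ? capE cap0]|st st' U step _ IH inv].
  by split=> //; rewrite -subr_ge0 -capE.
have [inv' _] := greedy_step_inv inv step; have [U1 wU sU] := IH inv'.
split=> //; apply: subset_trans sU.
by case: step => _ [S _ ->]; apply: subsetUl.
Qed.

(** * Oracle guarantees and exponential decay of the gap *)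

Lemma selected_ratio st S X : selected w p BR st S ->
  (viable F (rest st) X \/ exists2 s, s \in fringe st & X = [set s]) ->
  sum_over w X <= capacity st -> beta * ratio w p X <= ratio w p S.
Proof.
have ratio1 s : ratio w p [set s] = p s / w s by rewrite /ratio !sum_over1.
(* The best node is exactly optimal among fitting fringe nodes; [beta <= 1] weakens this to the
   oracle's guarantee, and the comparison made by the algorithm settles the mixed cases. *)
have node s : beta * (p s / w s) <= p s / w s.
  by rewrite ler_piMl// divr_ge0// ltW.
have := BR_spec (rest st) (capacity st).
move=> BRst sel Xc wX.
case: sel Xc wX => {S} [S BRS Smax|s [sZ sw smax] smaxS] [Xv|[x xZ ->]] wX.
- by rewrite BRS in BRst; apply: BRst.2.
- rewrite sum_over1 in wX; rewrite ratio1; apply: le_trans (node x) _.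
  have [s s_best] := best_node_exists xZ wX.
  have := Smax s s_best; rewrite -leNgt; apply: le_trans.
  by case: s_best => _ _; apply.
- case E: (BR (rest st) (capacity st)) BRst => [S|] BRst; last by case: (BRst X).
  by rewrite ratio1; apply: le_trans (ltW (smaxS S E)); apply: BRst.2.
- rewrite sum_over1 in wX; rewrite !ratio1; apply: le_trans (node x) _.
  exact: smax.
Qed.

Lemma approx_profit X : viable F G X -> sum_over w X <= k ->
  alpha * sum_over p X <= sum_over p (odflt set0 (BP G k)).
Proof.
move=> vX wX; have := BP_spec G k.
by case: (BP G k) => [S [_]|/(_ X)]; [apply|case].
Qed.

(** For a positive gap [g], the bound [1 - y <= expR (- y)] at [y = beta * x]; otherwise the left
    side is nonpositive. Here [a] is the fraction of capacity spent, [x] the fraction being added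
    and [q] its profit. *)
Lemma gap_step (Q a g x q : R) :
  0 <= Q -> 0 <= q -> beta * x * g <= q -> g <= Q * expR (- (beta * a)) ->
  g - q <= Q * expR (- (beta * (a + x))).
Proof.
move=> Q0 q0 gq ga; have [g0|g0] := leP g 0.
  apply: (@le_trans _ _ 0); first by rewrite subr_le0; apply: le_trans q0.
  by rewrite mulr_ge0// expR_ge0.
rewrite mulrDr opprD expRD mulrA.
apply: (@le_trans _ _ (g * expR (- (beta * x)))); last first.
  by rewrite ler_wpM2r// expR_ge0.
apply: (@le_trans _ _ (g * (1 + - (beta * x)))).
  by rewrite mulrDr mulr1 mulrN lerD2l lerN2 mulrC.
by rewrite ler_wpM2l ?expR_ge1Dx// ltW.
Qed.

Lemma dense_piece st T : loop_inv st -> feasible w G k T ->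
  T :\: chosen st != set0 ->
  exists X, [/\ X != set0,
    viable F (rest st) X \/ exists2 s, s \in fringe st & X = [set s],
    sum_over w X / k * (sum_over p T - sum_over p (chosen st)) <= sum_over p X
  & alpha * sum_over p X <= sum_over p (odflt set0 (BP G k))].
Proof.
move=> [resH fE _ _ _] [T1 wT] D0.
have [P [PD PP]] := residual_pieces F_viable resH T1.
have [X XP dens] := sum_partition_ratio w p PD D0.
have [Xv [X' [X'v sXX' sX'T]]] := PP X XP.
have wDk : sum_over w (T :\: chosen st) <= k.
  by apply: le_trans wT; apply: sum_over_sub (subsetDl _ _) => v; apply: ltW.
have k_gt0 : 0 < k by apply: lt_le_trans wDk; exact: w_sum_gt0.
exists X; split.
- by apply: contraTneq XP => ->; case/and3P: PD.
- by rewrite fE.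
- rewrite mulrAC ler_pdivrMr//.
  apply: le_trans (ler_wpM2l (p_sum_ge0 X) wDk).
  apply: le_trans dens; rewrite ler_wpM2l// lerBlDr -sum_overU.
    apply: sum_over_sub => //; apply/subsetP => v vT; rewrite !inE vT andbT.
    exact: orNb.
  by rewrite disjoints_subset subsetDr.
- apply: (@le_trans _ _ (alpha * sum_over p X')).
    by rewrite ler_wpM2l ?sum_over_sub// ltW.
  apply: approx_profit => //; apply: le_trans wT.
  by apply: sum_over_sub => // v; apply: ltW.
Qed.

(** Measured by weight spent rather than by iterations, so it can be carried along as a loop
    invariant. *)
Definition gap_bound T st : Prop :=
  sum_over p T - sum_over p (chosen st) <=
    sum_over p T * expR (- (beta * (sum_over w (chosen st) / k))).

(** [gap_step] is applied as if [X] were added: the spent fraction would then exceed 1, so the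
    exponent drops below [- beta]. *)
Lemma overflow_profit st T X :
  loop_inv st -> 0 < k -> gap_bound T st ->
  sum_over w X / k * (sum_over p T - sum_over p (chosen st)) <= sum_over p X ->
  capacity st < sum_over w X ->
  (1 - expR (- beta)) * sum_over p T <= sum_over p (chosen st) + sum_over p X.
Proof.
move=> [_ _ _ capE _] k_gt0 gap dense wX.
have gapX : beta * (sum_over w X / k) * (sum_over p T - sum_over p (chosen st))
    <= sum_over p X.
  rewrite -mulrA; set y := _ / k * _ in dense *.
  have [y0|y0] := leP 0 y; first by apply: le_trans dense; rewrite ler_piMl.
  by apply: le_trans (p_sum_ge0 X); rewrite pmulr_rle0 // ltW.
have := gap_step (p_sum_ge0 T) (p_sum_ge0 X) gapX gap; rewrite -mulrDl => le1.
rewrite mulrBl mul1r lerBlDr -lerBlDl opprD addrA [expR _ * _]mulrC.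
apply: le_trans le1 _; rewrite ler_wpM2l// ler_expR lerN2 ler_peMr ?ltW//.
by rewrite ltr_pdivlMr// mul1r -ltrBlDl -capE.
Qed.

Lemma greedy_loop_profit st U T :
  greedy_loop w p F BR G st U -> loop_inv st -> feasible w G k T ->
  gap_bound T st ->
  alpha * (1 - expR (- beta)) * sum_over p T <=
    sum_over p U + sum_over p (odflt set0 (BP G k)).
Proof.
move=> loop inv fT; set Smax := odflt _ _.
(* [U'] stands for the final set: once [T] is exhausted or the dense piece overflows, the bound
   already holds and survives later selections by monotonicity of profit. *)
have fit_or_done st' U' : loop_inv st' -> chosen st' \subset U' ->
    gap_bound T st' ->
    (exists X, [/\ X != set0, sum_over w X <= capacity st',
      viable F (rest st') X \/ exists2 s, s \in fringe st' & X = [set s]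
    & sum_over w X / k * (sum_over p T - sum_over p (chosen st'))
        <= sum_over p X]) \/
    alpha * (1 - expR (- beta)) * sum_over p T <= sum_over p U' + sum_over p Smax.
  move=> {}inv sU' gap; have leU := sum_over_sub p_ge0 sU'.
  have [D0|D0] := eqVneq (T :\: chosen st') set0.
    right; apply: (@le_trans _ _ (sum_over p U')); last by rewrite lerDl.
    apply: (@le_trans _ _ (sum_over p T)); last first.
      by apply: le_trans leU; apply: sum_over_sub; rewrite // -setD_eq0 D0.
    have eb1 : expR (- beta) <= 1 by rewrite -expR0 ler_expR oppr_le0 ltW.
    by rewrite ler_piMl// mulr_ile1 ?(ltW alpha_gt0) ?subr_ge0 ?gerBl ?expR_ge0.
  have [X [X0 Xc dense pX]] := dense_piece inv fT D0.
  have [wX|wX] := leP (sum_over w X) (capacity st'); [left|right].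
    by exists X.
  have k_gt0 : 0 < k.
    apply: lt_le_trans fT.2; apply: w_sum_gt0.
    by apply: contraNneq D0 => ->; rewrite set0D.
  have leX := overflow_profit inv k_gt0 gap dense wX.
  rewrite -mulrA; apply: le_trans (ler_wpM2l (ltW alpha_gt0) leX) _.
  by rewrite mulrDr lerD//; apply: le_trans leU; rewrite ler_piMl.
elim: loop inv => {st U} [st stop|st st' U step loop IH] inv gap.
  (* A piece that fits would contradict the end of the loop. *)
  have [[X [X0 wX Xc _]]|//] := fit_or_done _ _ inv (subxx _) gap.
  case: stop; case: Xc => [Xv|[s sZ XE]]; [left; exists X|right; exists s] => //.
  by rewrite XE sum_over1 in wX.
have [inv' _] := greedy_step_inv inv step.
have [_ _ sU'] := greedy_loop_inv loop inv'.
case: step sU' inv' loop IH => _ [S sel ->] sU' inv' loop IH.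
have sU := subset_trans (subsetUl _ S : chosen st \subset _) sU'.
have [[X [X0 wX Xc dense]]|//] := fit_or_done _ _ inv sU gap.
apply: IH => //; rewrite /gap_bound /=.
have [S0 _ dS _] := selected_sub inv sel.
(* The added fraction is [sum_over w S / k]. The ratio of [S] is at least [beta] times that of [X],
   and the weight of [X] cancels against its density bound. *)
rewrite !sum_overU// opprD addrA mulrDl; apply: gap_step => //.
have wX0 := w_sum_gt0 X0; have wS0 := w_sum_gt0 S0.
have := selected_ratio sel Xc wX; rewrite /ratio => leS.
have -> : sum_over p S = sum_over w S * (sum_over p S / sum_over w S).
  by rewrite mulrCA divff ?mulr1 ?gt_eqF.
apply: le_trans (ler_wpM2l (ltW wS0) leS).
rewrite [X in _ <= X](_ : _ =
    beta * (sum_over w S / sum_over w X) * sum_over p X); last first.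
  by rewrite mulrCA -!mulrA [_^-1 * _]mulrC.
apply: le_trans (ler_wpM2l _ dense); last first.
  by rewrite mulr_ge0 ?divr_ge0// ltW.
by rewrite -!mulrA mulKf// gt_eqF.
Qed.

End Greedy.

(** * The approximation guarantee *)

Theorem theorem1 (R : realType) (dir : bool) (V : finType) (G : graph dir V)
  (w p : V -> R) (k : R)
  (w_gt0 : forall v, 0 < w v) (p_ge0 : forall v, 0 <= p v) (k_ge0 : 0 <= k)
  (F : graph_family dir) (F_viable : viable_family F G)
  (alpha beta : R)
  (alpha_gt0 : 0 < alpha) (alpha_le1 : alpha <= 1)
  (beta_gt0 : 0 < beta) (beta_le1 : beta <= 1)
  (BP BR : oracle R dir V)
  (BP_spec : best_profit_viable w p F alpha BP)
  (BR_spec : best_ratio_viable w p F beta BR) :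
  greedy_is_approximation w p F (alpha / 2 * (1 - 1 / expR beta)) BP BR G k.
Proof.
have inv0 := loop_inv_init w G k_ge0; split; first exact: loop_inv_acc BR_spec _ inv0.
  have [U loopU] := greedy_loop_exists BR_spec inv0.
  set Smax := odflt set0 (BP G k).
  have [le_max|lt_max] := leP (sum_over p U) (sum_over p Smax).
    by exists Smax; exists U => //; left.
  by exists U; exists U => //; right; rewrite ltW.
move=> S [U loopU]; set Smax := odflt set0 (BP G k) => /= SP.
have [U1 wU _] := greedy_loop_inv BR_spec loopU inv0.
have SmaxF : feasible w G k Smax.
  have := BP_spec G k; rewrite /Smax; case: (BP G k) => [X [[[_ X1 _] wX] _]|_] /=.
    by [].
  by split; [case: inv0 | rewrite sum_over0].
split; first by case: SP => -[-> _].
move=> T fT; have gap0 : gap_bound w p k beta T (init_state G k).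
  by rewrite /gap_bound /= !sum_over0 subr0 mul0r mulr0 oppr0 expR0 mulr1.
have := greedy_loop_profit w_gt0 p_ge0 F_viable alpha_gt0 alpha_le1 beta_gt0
  beta_le1 BP_spec BR_spec loopU inv0 fT gap0; rewrite -/Smax => le2.
(* Source of the factor 1/2: the better of two sets has at least half their total profit. *)
have le_S : sum_over p U + sum_over p Smax <= sum_over p S * 2.
  by rewrite mulr_natr mulr2n; case: SP => -[-> le]; rewrite lerD.
rewrite div1r -expRN mulrAC [alpha / 2 * _]mulrAC mulrAC ler_pdivrMr//.
apply: le_trans le_S; apply: le_trans le2.
by rewrite mulrAC.
Qed.
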